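(* Let $\Omega\subseteq\mathbb{R}^n$ be open and let $u=(u_\varepsilon)\in\mathcal{P}^{\mathrm{e}}(\Omega)=\prod_{\varepsilon\in I^{\mathrm{e}}}\mathcal{C}^\infty(\Omega_\varepsilon,\mathbb{R})$. Then: (i) $u^\vee\in\mathcal{E}_M^{\mathrm{e}}(\Omega)$ if and only if $\forall K\Subset\Omega\ \forall\alpha\in\mathbb{N}^n\ \exists N\in\mathbb{N}:\ \sup_{x\in K}|\partial^\alpha u_\varepsilon(x)|=O(\underline{\varepsilon}^{-N})$ as $\varepsilon\in\mathbb{I}^{\mathrm{e}}$; (ii) $u^\vee\in\mathcal{N}^{\mathrm{e}}(\Omega)$ if and only if $\forall K\Subset\Omega\ \forall\alpha\in\mathbb{N}^n\ \forall m\in\mathbb{N}:\ \sup_{x\in K}|\partial^\alpha u_\varepsilon(x)|=O(\underline{\varepsilon}^{m})$ as $\varepsilon\in\mathbb{I}^{\mathrm{e}}$.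
   Context: $\mathbb{N}=\{0,1,2,\dots\}$, $n\ge1$; $K\Subset\Omega$ means $K$ is a compact subset of $\Omega$. $\mathcal{D}(\mathbb{R}^n)$ is the space of (real-valued) test functions. For $\varphi\in\mathcal{D}(\mathbb{R}^n)$ and $r>0$, $(r\odot\varphi)(y):=r^{-n}\varphi(y/r)$. For $\varphi\neq0$, $\underline{\varphi}:=\mathrm{diam}(\mathrm{supp}(\varphi))$. Index structure: $\mathcal{A}_0:=\{\varphi\in\mathcal{D}(\mathbb{R}^n)\mid\int\varphi=1\}$; for $q\in\mathbb{N}$, $\mathcal{A}_q:=\{\varphi\in\mathcal{A}_0\mid\int x^\alpha\varphi(x)\,dx=0\ \forall\alpha\in\mathbb{N}^n,\ 1\le|\alpha|\le q\}$. $\mathbb{I}^{\mathrm{e}}=(I^{\mathrm{e}},\le,\mathcal{I}^{\mathrm{e}})$ with $I^{\mathrm{e}}:=\mathcal{A}_0$, $\mathcal{I}^{\mathrm{e}}:=\{\mathcal{A}_q\mid q\in\mathbb{N}\}$, and $\varepsilon\le e$ iff there is $r\in(0,1]$ with $\varepsilon=r\odot e$. Put $(\emptyset,e]:=\{\varepsilon\in I^{\mathrm{e}}\mid\varepsilon\le e\}$ and $A_{\le e}:=(\emptyset,e]\cap A$. Big-O: for real nets indexed by $I^{\mathrm{e}}$, $x_\varepsilon=O(y_\varepsilon)$ as $\varepsilon\in\mathbb{I}^{\mathrm{e}}$ means: there is $A\in\mathcal{I}^{\mathrm{e}}$ such that for all $a\in A$ there are $H>0$ and $\varepsilon_0\in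 A_{\le a}$ with $|x_\varepsilon|\le H|y_\varepsilon|$ for all $\varepsilon\in A_{\le\varepsilon_0}$. Full algebra: $U(\Omega):=\{(\varphi,x)\in\mathcal{A}_0\times\Omega\mid\mathrm{supp}(\varphi)\subseteq\Omega-x\}$ and, for $\varphi\in\mathcal{A}_0$, $\Omega_\varphi:=\{x\in\Omega\mid\mathrm{supp}(\varphi)\subseteq\Omega-x\}$. $\mathcal{E}^{\mathrm{e}}(\Omega)$ is the set of all $R:U(\Omega)\to\mathbb{R}$ such that $R(\varphi,-)$ is smooth on $\Omega_\varphi$ for all $\varphi\in\mathcal{A}_0$. $R\in\mathcal{E}^{\mathrm{e}}_M(\Omega)$ iff $R\in\mathcal{E}^{\mathrm{e}}(\Omega)$ and $\forall K\Subset\Omega\,\forall\alpha\in\mathbb{N}^n\,\exists N\in\mathbb{N}\,\forall\varphi\in\mathcal{A}_N$: $\sup_{x\in K}|\partial^\alpha R(r\odot\varphi,x)|=O(r^{-N})$ as $r\to0^+$. $R\in\mathcal{N}^{\mathrm{e}}(\Omega)$ iff $R\in\mathcal{E}^{\mathrm{e}}(\Omega)$ and $\forall K\Subset\Omega\,\forall\alpha\in\mathbb{N}^n\,\forall m\in\mathbb{N}\,\exists q\in\mathbb{N}\,\forall\varphi\in\mathcal{A}_q$: $\sup_{x\in K}|\partial^\alpha R(r\odot\varphi,x)|=O(r^{m})$ as $r\to0^+$. Here $\partial^\alpha$ acts on the variable $x$. For $u\in\mathcal{P}^{\mathrm{e}}(\Omega)$, $u^\vee:U(\Omega)\to\mathbb{R}$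 is $u^\vee(\varphi,x):=u_\varphi(x)$. Convention: the supremum over $K$ is meaningful when $K\subseteq\Omega_\varepsilon$; for fixed $\varphi$ and $K$ this holds for $\varepsilon=r\odot\varphi$ with $r$ sufficiently small, and the (arbitrary) value assigned to the supremum when $K\not\subseteq\Omega_\varepsilon$ (say $0$) is irrelevant. *)

(* Defs.v *)
From HB Require Import structures.
From mathcomp Require Import all_boot all_order all_algebra.
From mathcomp Require Import all_classical all_reals all_analysis.
Import Order.TTheory GRing.Theory Num.Theory.
Import numFieldNormedType.Exports.

Set Implicit Arguments.
Unset Strict Implicit.
Unset Printing Implicit Defensive.

Local Open Scope classical_set_scope.
Local Open Scope ring_scope.

(* Lebesgue measure on R^n.  Adding one coordinate at a time, it is the image  *)
(* of the product of the Lebesgue measures on R and R^n under (t, v) |-> t::v. *)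
Section lebesgue_step.
Context (R : realType) (n : nat).
Local Notation T := (measurableTypeR R).
Variable mu : {sigma_finite_measure set (n.-tuple T) -> \bar R}.

Definition tcons (p : T * n.-tuple T) : n.+1.-tuple T := [tuple of p.1 :: p.2].

Lemma measurable_tcons : measurable_fun [set: T * n.-tuple T] tcons.
Proof. exact: measurable_cons. Qed.

Definition lebesgue_step : set (n.+1.-tuple T) -> \bar R :=
  pushforward (@lebesgue_measure R \x mu)%E tcons.

Let step0 : lebesgue_step set0 = 0%E.
Proof. by rewrite /lebesgue_step /pushforward preimage_set0 measure0. Qed.

Let step_ge0 A : (0 <= lebesgue_step A)%E.
Proof. by rewrite /lebesgue_step /pushforward; apply: measure_ge0. Qed.

Let step_sigma_additive : semi_sigma_additive lebesgue_step.
Proof.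
move=> F mF tF mUF; rewrite /lebesgue_step /pushforward preimage_bigcup.
apply: measure_semi_sigma_additive.
- by move=> k; rewrite -[X in measurable X]setTI; exact: measurable_tcons.
- apply/trivIsetP => /= i j _ _ ij; rewrite -preimage_setI.
  by move/trivIsetP : tF => /(_ _ _ _ _ ij) ->//; rewrite preimage_set0.
- by rewrite -preimage_bigcup -[X in measurable X]setTI; exact: measurable_tcons.
Qed.

HB.instance Definition _ := isMeasure.Build _ _ _
  lebesgue_step step0 step_ge0 step_sigma_additive.

Let step_sigma_finite : sigma_finite [set: n.+1.-tuple T] lebesgue_step.
Proof.
have /sigma_finiteP[F [FT ndF Foo]] := sigma_finiteT (@lebesgue_measure R).
have /sigma_finiteP[G [GT ndG Goo]] := sigma_finiteT mu.
pose H k := [set v : n.+1.-tuple T | F k (thead v) /\ G k [tuple of behead v]].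
have tconsH k : tcons @^-1` H k = F k `*` G k.
  apply/seteqP; split => -[t v] /=; rewrite /H /= theadE.
    by move=> -[? Gv]; split => //=; congr (G k _) : Gv; exact/val_inj.
  by move=> -[? Gv]; split => //; congr (G k _) : Gv; exact/val_inj.
exists H.
  apply/esym; rewrite -subTset => v _.
  have [i _ Fi] : (\bigcup_i F i) (thead v) by rewrite -FT.
  have [j _ Gj] : (\bigcup_j G j) [tuple of behead v] by rewrite -GT.
  exists (maxn i j) => //; split.
    by move: Fi; exact/subsetPset/ndF/leq_maxl.
  by move: Gj; exact/subsetPset/ndG/leq_maxr.
move=> k; have [mF Fk] := Foo k; have [mG Gk] := Goo k; split.
  apply: measurableI; rewrite -[X in measurable X]setTI.
    exact: (measurable_tnth ord0).
  exact: measurable_behead.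
rewrite /lebesgue_step /pushforward tconsH product_measure1E//.
by rewrite lte_mul_pinfty// ge0_fin_numE.
Qed.

HB.instance Definition _ := Measure_isSigmaFinite.Build _ _ _
  lebesgue_step step_sigma_finite.

End lebesgue_step.

Fixpoint lebesgue_measuren (R : realType) (n : nat) :
    {sigma_finite_measure set (n.-tuple (measurableTypeR R)) -> \bar R} :=
  match n with
  | 0 => \d_([tuple] : 0.-tuple (measurableTypeR R))
  | m.+1 => lebesgue_step (lebesgue_measuren R m)
  end.

Definition integraln (R : realType) (n : nat) (f : 'rV[R]_n -> R) : R :=
  \int[lebesgue_measuren R n]_t f (\row_i tnth t i).

Section calculus.
Context (R : realType) (n : nat).
Implicit Types (f : 'rV[R]_n -> R) (U K : set 'rV[R]_n) (x y : 'rV[R]_n).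

Definition partial (i : 'I_n) f : 'rV[R]_n -> R :=
  fun x => 'D_(delta_mx 0 i) f x.

(* All iterated partial derivatives, taken in any order, exist and are         *)
(* continuous at the points of U.  As U will be open, this does not depend on  *)
(* the values of f off U.                                                      *)
Definition smooth_on U f :=
  forall (s : seq 'I_n) x, U x ->
    {for x, continuous (foldr partial f s)} /\
    forall i, derivable (foldr partial f s) x (delta_mx 0 i).

(* A fixed order of differentiation is chosen (the derivatives with respect to *)
(* the last coordinate are taken first); on smooth functions it is immaterial. *)
Definition mpartial (alpha : 'I_n -> nat) f : 'rV[R]_n -> R :=
  foldr (fun i g => iter (alpha i) (partial i) g) f (enum 'I_n).

Definition supp f : set 'rV[R]_n := closure [set x | f x != 0].

Definition test_function f := smooth_on setT f /\ compact (supp f).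

(* The norm of the library on 'rV[R]_n is the sup norm. *)
Definition eucl_dist x y : R := Num.sqrt (\sum_i (x 0 i - y 0 i) ^+ 2).

Definition diam U : R := sup [set eucl_dist x y | x in U & y in U].

Definition compact_in K U := compact K /\ K `<=` U.

(* 0 is a conventional value: K `<=` U fails only for indices whose support is *)
(* too large, which the asymptotic conditions discard.                         *)
Definition sup_abs U K f : R :=
  if `[< K `<=` U >] then sup [set `|f x| | x in K] else 0.

End calculus.

Section full_index_set.
Context (R : realType) (n : nat).
Local Notation net_index := ('rV[R]_n -> R).
Implicit Types (phi e : net_index) (A : set net_index).

Definition dilate (r : R) phi : net_index := fun y => r ^- n * phi (r^-1 *: y).

Definition sdiam phi : R := diam (supp phi).

Definition A0 : set net_index :=
  [set phi | test_function phi /\ integraln phi = 1].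

Definition Aq (q : nat) : set net_index :=
  [set phi | A0 phi /\ forall alpha : 'I_n -> nat,
     (1 <= \sum_i alpha i <= q)%N ->
     integraln (fun x => (\prod_i x 0 i ^+ alpha i) * phi x) = 0].

Definition index_sets : set (set net_index) := range Aq.

Definition index_le (eps e : net_index) :=
  exists r : R, 0 < r <= 1 /\ eps = dilate r e.

Definition below A e : set net_index :=
  [set eps | A0 eps /\ index_le eps e] `&` A.

Definition bigO_e (x y : net_index -> R) :=
  exists A, index_sets A /\
    forall a, A a ->
      exists H, 0 < H /\ exists eps0, below A a eps0 /\
        forall eps, below A eps0 eps -> `|x eps| <= H * `|y eps|.

End full_index_set.

(* A net (u_phi) is a total function of phi and x, and a function on the       *)
(* domain {(phi, x) | phi in A0, x in Omega_at Omega phi} is a total function  *)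
(* on pairs.  The values off that domain are irrelevant: each condition below  *)
(* reads f only through its derivatives at points of the open set              *)
(* Omega_at Omega phi, for an index phi in A0.                                 *)
Section full_algebra.
Context (R : realType) (n : nat) (Omega : set 'rV[R]_n).
Local Notation V := 'rV[R]_n.

Definition Omega_at (phi : V -> R) : set V :=
  [set x | Omega x /\ supp phi `<=` [set y - x | y in Omega]].

Definition Pe : set ((V -> R) -> V -> R) :=
  [set u | forall phi, A0 phi -> smooth_on (Omega_at phi) (u phi)].

Definition Ee : set ((V -> R) * V -> R) :=
  [set F | forall phi, A0 phi ->
     smooth_on (Omega_at phi) (fun x => F (phi, x))].

Definition sup_partial (K : set V) (alpha : 'I_n -> nat) (phi : V -> R)
    (f : V -> R) : R :=
  sup_abs (Omega_at phi) K (mpartial alpha f).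

Definition EMe : set ((V -> R) * V -> R) :=
  [set F | Ee F /\ forall K, compact_in K Omega ->
     forall alpha : 'I_n -> nat, exists N : nat, forall phi, Aq N phi ->
       (fun r : R => sup_partial K alpha (dilate r phi)
                       (fun x => F (dilate r phi, x)))
       =O_ (0^'+) (fun r => r ^- N)].

Definition Ne : set ((V -> R) * V -> R) :=
  [set F | Ee F /\ forall K, compact_in K Omega ->
     forall (alpha : 'I_n -> nat) (m : nat), exists q : nat,
       forall phi, Aq q phi ->
         (fun r : R => sup_partial K alpha (dilate r phi)
                         (fun x => F (dilate r phi, x)))
         =O_ (0^'+) (fun r => r ^+ m)].

End full_algebra.

Definition vee (R : realType) (n : nat) (u : ('rV[R]_n -> R) -> 'rV[R]_n -> R) :
  ('rV[R]_n -> R) * 'rV[R]_n -> R := fun p => u p.1 p.2.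

(* Main.v *)
Require Import Defs.
From HB Require Import structures.
From mathcomp Require Import all_boot all_order all_algebra.
From mathcomp Require Import all_classical all_reals all_analysis.
Import Order.TTheory GRing.Theory Num.Theory.
Import numFieldNormedType.Exports.
Local Open Scope classical_set_scope.
Local Open Scope ring_scope.

(** Both asymptotic conditions speak of the same nets.  An index below [phi] is
a dilate [dilate r phi] with [0 < r <= 1], dilation multiplies the diameter of
the support by [r], and that diameter is positive because [n >= 1].  Hence along
the indices below a fixed [phi] a bound by a power of [sdiam] is, up to the
constant factor given by the same power of [sdiam phi], a bound by that power of
the dilation parameter [r].  This is [bigO_e_sdiam], stated for an arbitrary
multiplicative gauge [g], so that it covers [s ^- N] and [s ^+ m].  Part (ii) is
then immediate.  In part (i) the number [N] that bounds the growth also selects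
the set [Aq N], whereas [bigO_e] lets the two be chosen separately; replacing
both by their maximum is harmless since the sets [Aq q] decrease in [q] and
[r ^- N] increases with [N] for [r <= 1].

Passing from an index to its dilates stays inside [Aq q] ([Aq_dilate]), which
rests on the behaviour of derivatives under dilation ([foldr_partial_dilate])
and on the substitution rule for homotheties in the integral over R^n
([integraln_scale_comp]).  The rule is obtained for functions that are not
assumed measurable: a measurable bijection with measurable inverse induces a
bijection of the nonnegative simple functions, and the integral of a nonnegative
function is a supremum of integrals of such functions. *)

(** * Substitution by a measurable bijection that scales a measure *)

Section integral_scale.
Context d (T : measurableType d) (R : realType).
Context (mu : {measure set T -> \bar R}).
Import HBNNSimple.

Lemma nnsfun_scale_comp (a : R) (S : T -> T) (h : {nnsfun T >-> R}) : 0 < a ->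
  measurable_fun [set: T] S ->
  exists k : {nnsfun T >-> R}, forall x, k x = a * h (S x).
Proof.
move=> a0 mS.
have fi : finite_set (range (h \o S)).
  by apply: sub_finite_set (fimfunP h) => _ [x _ <-]; exists (S x).
have mh : measurable_fun [set: T] (h \o S) by exact: measurableT_comp.
have h0 x : 0 <= (h \o S) x by rewrite /=.
pose k1 := isMeasurableFun.Build _ _ _ _ _ mh.
pose k2 := FiniteImage.Build _ _ _ fi.
pose k3 := isNonNegFun.Build _ _ _ h0.
pose k : {nnsfun T >-> R} := HB.pack (h \o S) k1 k2 k3.
by exists (scale_nnsfun k (ltW a0)).
Qed.

Context (c : R) (S S' : T -> T).
Hypothesis c0 : 0 < c.
Hypothesis mS : measurable_fun [set: T] S.
Hypothesis mS' : measurable_fun [set: T] S'.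
Hypotheses (SK : cancel S S') (S'K : cancel S' S).
Hypothesis muS : forall A, measurable A -> mu (S @^-1` A) = (c%:E * mu A)%E.

Lemma sintegral_comp (h : {nnsfun T >-> R}) :
  sintegral mu (h \o S) = (c%:E * sintegral mu h)%E.
Proof.
rewrite /sintegral ge0_mule_fsumr; last exact: nnsfun_mulemu_ge0.
apply: eq_fsbigr => x _.
by rewrite comp_preimage muS// muleCA.
Qed.

Lemma sintegral_scale_comp (a : R) (h k : {nnsfun T >-> R}) :
  (forall x, h x = a * k (S x)) ->
  sintegral mu h = ((a * c)%:E * sintegral mu k)%E.
Proof.
move=> hk.
have -> : sintegral mu k = (c^-1%:E * sintegral mu (k \o S))%E.
  by rewrite sintegral_comp muleA -EFinM mulVf ?gt_eqF// mul1e.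
rewrite muleA -EFinM mulfK ?gt_eqF//.
have [g gE] := nnsfun_scale_comp 1 S k ltr01 mS.
rewrite (@eq_sintegral _ _ _ mu g (k \o S)) => [|x]; last first.
  by rewrite /= gE mul1r.
rewrite -sintegralrM; apply: eq_sintegral => x /=.
by rewrite hk gE mul1r.
Qed.

(** No measurability of [f] is needed: simple functions below [a * f \o S] and
simple functions below [f] correspond to each other through [S] and [S']. *)
Lemma ge0_integral_scale_comp (a : R) (f : T -> \bar R) : 0 < a ->
  (forall x, 0 <= f x)%E ->
  (\int[mu]_x (a%:E * f (S x)) = (a * c)%:E * \int[mu]_x f x)%E.
Proof.
move=> a0 f0.
rewrite !ge0_integralTE//; last first.
  by move=> x; apply: mule_ge0; rewrite ?f0// lee_fin ltW.
rewrite -ereal_sup_pZl ?mulr_gt0//; congr ereal_sup.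
apply/seteqP; split => [_ [h /= hf <-]|_ [_ [k /= kf <-] <-]].
  have ai0 : 0 < a^-1 by rewrite invr_gt0.
  have [k kE] := nnsfun_scale_comp a^-1 S' h ai0 mS'.
  exists (sintegral mu k).
    exists k => //= x; rewrite kE /= EFinM lee_pdivrMl//.
    by have := hf (S' x); rewrite S'K.
  apply/esym/sintegral_scale_comp => x.
  by rewrite kE SK mulVKf ?gt_eqF.
have [h hE] := nnsfun_scale_comp a S k a0 mS.
exists h => [x|]; last exact: sintegral_scale_comp.
by rewrite hE /= EFinM lee_pmul2l.
Qed.

Lemma integral_scale_comp (a : R) (f : T -> \bar R) : 0 < a ->
  (\int[mu]_x (a%:E * f (S x)) = (a * c)%:E * \int[mu]_x f x)%E.
Proof.
move=> a0; rewrite [LHS]integralE [in RHS]integralE.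
rewrite (ge0_funeposM _ (ltW a0)) (ge0_funenegM _ (ltW a0)).
have -> : ((fun y => f (S y))^\+ = fun x => f^\+ (S x))%E.
  by apply/funext => x; rewrite !funeposE.
have -> : ((fun y => f (S y))^\- = fun x => f^\- (S x))%E.
  by apply/funext => x; rewrite !funenegE.
rewrite (ge0_integral_scale_comp a (f^\+)%E)//.
rewrite (ge0_integral_scale_comp a (f^\-)%E)//.
have ac0 : 0 < a * c by rewrite mulr_gt0.
(* Multiplication by a positive real distributes over the difference of the two
   nonnegative integrals even when both are infinite. *)
have : (0 <= \int[mu]_x f^\- x)%E by apply: integral_ge0.
have : (0 <= \int[mu]_x f^\+ x)%E by apply: integral_ge0.
have acy : ((a * c)%:E * +oo = +oo)%E by rewrite gt0_muley ?lte_fin.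
have acNy : ((a * c)%:E * -oo = -oo)%E by rewrite gt0_muleNy ?lte_fin.
case: (integral _ _ (f^\+)%E) => [b| |] //;
  case: (integral _ _ (f^\-)%E) => [b'| |] // _ _;
  rewrite ?acy /= ?acNy ?acy //.
by congr EFin; rewrite mulrBr.
Qed.

Lemma Rintegral_scale_comp (a : R) (f : T -> R) : 0 < a ->
  \int[mu]_x (a * f (S x)) = a * c * \int[mu]_x f x.
Proof.
move=> a0; have ac0 : 0 < a * c by rewrite mulr_gt0.
rewrite /Rintegral (integral_scale_comp a (EFin \o f) a0).
case: integral => [b| |] //=.
  by rewrite gt0_muley ?lte_fin //= mulr0.
by rewrite gt0_muleNy ?lte_fin //= mulr0.
Qed.

End integral_scale.

(** * Homotheties and Lebesgue measure *)

Section lebesgue_scale.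
Context (R : realType).
Local Notation T := (measurableTypeR R).

Lemma lebesgue_measure_homothety (r : R) (A : set T) : 0 < r -> measurable A ->
  lebesgue_measure (( *%R r : T -> T) @^-1` A) =
  ((r^-1)%:E * lebesgue_measure A)%E.
Proof.
move=> r0 mA.
have mr : measurable_fun [set: T] ( *%R r : T -> T).
  exact: measurable_realfun.mulrl_measurable.
pose m : {measure set T -> \bar R} :=
  mscale (NngNum (ltW r0)) (pushforward lebesgue_measure ( *%R r : T -> T)).
have mE B :
  m mr B = (r%:E * lebesgue_measure (( *%R r : T -> T) @^-1` B))%E by [].
rewrite (@lebesgue_measure_unique _ (m mr) _ A) //.
  by rewrite mE muleA -EFinM mulVf ?gt_eqF// mul1e.
move=> _ [[a b] _ <-]; rewrite mE /=.
have -> : ( *%R r : T -> T) @^-1` `]a, b] = `]r^-1 * a, r^-1 * b]%classic.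
  apply/seteqP; split => x /=; rewrite !in_itv /= => /andP[];
    by rewrite ltr_pdivrMl// ler_pdivlMl// => -> ->.
rewrite !lebesgue_measure_itv /= !lte_fin ltr_pM2l ?invr_gt0//.
case: ifP => _; last by rewrite mule0.
by rewrite -!EFinB -EFinM mulrBr !mulVKf ?gt_eqF.
Qed.

End lebesgue_scale.

(** The homothety of ratio [r] on R^n, with points encoded as tuples. *)
Definition tscale (R : realType) n (r : R) (t : n.-tuple (measurableTypeR R)) :
  n.-tuple (measurableTypeR R) := map_tuple ( *%R r) t.

Lemma measurable_tscale (R : realType) n (r : R) :
  measurable_fun setT (@tscale R n r).
Proof.
apply/measurable_fun_tnthP => i.
have -> : (tnth (T:=measurableTypeR R))^~ i \o tscale R n r =
    (fun t => r * tnth t i).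
  by apply/funext => t; rewrite /= tnth_map.
apply: (measurableT_comp (measurable_realfun.mulrl_measurable r)).
exact: measurable_tnth.
Qed.

Lemma tscaleK (R : realType) n (r : R) : r != 0 ->
  cancel (@tscale R n r) (tscale R n r^-1).
Proof.
by move=> r0 t; apply: eq_from_tnth => i; rewrite !tnth_map mulKf.
Qed.

Lemma lebesgue_measuren_scale (R : realType) n (r : R)
    (A : set (n.-tuple (measurableTypeR R))) : 0 < r -> measurable A ->
  lebesgue_measuren R n (tscale R n r @^-1` A) =
  ((r ^- n)%:E * lebesgue_measuren R n A)%E.
Proof.
move=> r0; elim: n A => [|n IH] A mA.
  have -> : tscale R 0 r @^-1` A = A.
    by apply/seteqP; split=> t /=; rewrite (_ : tscale _ _ _ t = t) //;
       rewrite (tuple0 t) tuple0.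
  by rewrite expr0 invr1 mul1e.
rewrite [LHS]/= /lebesgue_step /pushforward /product_measure1.
pose f t := lebesgue_measuren R n (xsection (tcons (n:=n) @^-1` A) t).
(* The section at [t] of the preimage of [A] is the preimage of the section of
   [A] at [r * t], to which the induction hypothesis applies. *)
transitivity (\int[@lebesgue_measure R]_t ((r ^- n)%:E * f (r * t)%R))%E.
  apply: eq_integral => t _ /=.
  rewrite /f -IH; last first.
    apply: measurable_xsection; rewrite -[X in measurable X]setTI.
    exact: measurable_tcons.
  congr (lebesgue_measuren R n _); apply/seteqP; split => v /=;
    rewrite /xsection /= !inE /= /tcons /=; congr A; exact/val_inj.
rewrite (@integral_scale_comp _ _ _ lebesgue_measure r^-1 ( *%R r)
  ( *%R r^-1)).
- by rewrite exprSr invfM mulrC.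
- by rewrite invr_gt0.
- exact: measurable_realfun.mulrl_measurable.
- exact: measurable_realfun.mulrl_measurable.
- by apply: mulKf; rewrite gt_eqF.
- by apply: mulVKf; rewrite gt_eqF.
- by move=> B mB; exact: lebesgue_measure_homothety.
- by rewrite invr_gt0 exprn_gt0.
Qed.

Lemma integraln_scale_comp (R : realType) n (a r : R) (f : 'rV[R]_n -> R) :
  0 < a -> 0 < r ->
  integraln (fun x => a * f (r *: x)) = a * r ^- n * integraln f.
Proof.
move=> a0 r0; have rn0 : r != 0 by rewrite gt_eqF.
rewrite /integraln.
rewrite -(@Rintegral_scale_comp _ _ _ (lebesgue_measuren R n) _ (tscale R n r)
  (tscale R n r^-1)) //.
- congr fine; apply: eq_integral => t _; congr (_ * f _)%:E.
  by apply/rowP => i; rewrite !mxE tnth_map.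
- by rewrite invr_gt0 exprn_gt0.
- exact: measurable_tscale.
- exact: measurable_tscale.
- exact: tscaleK.
- by rewrite -{2}(invrK r); apply: tscaleK; rewrite invr_eq0.
- by move=> A mA; exact: lebesgue_measuren_scale.
Qed.

(** * Dilations of test functions *)

Section derivative_scale.
Context (R : realType) (n : nat).
Local Notation V := 'rV[R]_n.

Lemma cvg_dnbhs0_mulr (k : R) : k != 0 -> h * k @[h --> 0^'] `=>` 0^'.
Proof.
move=> k0 A [e /= e0 eA].
exists (e / `|k|) => [|h /=]; first by rewrite /= divr_gt0 // normr_gt0.
rewrite /ball_ /= !sub0r !normrN => he h0; apply: eA => /=.
  by rewrite sub0r normrN normrM -ltr_pdivlMr ?normr_gt0.
by rewrite mulf_neq0.
Qed.

Lemma is_derive_scale_comp (c k : R) (g : V -> R) (x v : V) : k != 0 ->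
  derivable g (k *: x) v ->
  is_derive x v (fun y => c * g (k *: y)) (c * k * 'D_v g (k *: x)).
Proof.
move=> k0 dg.
have H : h^-1 *: (((fun y => c * g (k *: y)) \o shift x) (h *: v) -
    c * g (k *: x)) @[h --> 0^'] --> c * k * 'D_v g (k *: x).
  (* The difference quotient at [h] is, up to the factor [c * k], that of [g]
     at [h * k]. *)
  have -> : (fun h => h^-1 *:
      (((fun y => c * g (k *: y)) \o shift x) (h *: v) - c * g (k *: x))) =
    (fun h => c * k * ((h * k)^-1 *:
      ((g \o shift (k *: x)) ((h * k) *: v) - g (k *: x)))).
    apply/funext => h /=.
    rewrite (_ : k *: (h *: v + x) = (h * k) *: v + k *: x); last first.
      by rewrite scalerDr scalerA mulrC.
    rewrite -mulrBr /GRing.scale /= invfM.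
    by rewrite [h^-1 / k]mulrC -!mulrA mulVKf// mulrCA.

  apply: cvgM; first exact: cvg_cst.
  exact: (cvg_comp _ _ (cvg_dnbhs0_mulr k k0) dg).
by split; [apply/cvg_ex; exists (c * k * 'D_v g (k *: x))|exact: cvg_lim].
Qed.

End derivative_scale.

Section dilate.
Context (R : realType) (n : nat).
Local Notation V := 'rV[R]_n.
Implicit Types (phi : V -> R) (r s : R).

Lemma dilateM r s phi : dilate s (dilate r phi) = dilate (s * r) phi.
Proof.
apply/funext => x; rewrite /dilate mulrA scalerA exprMn !invfM.
congr (_ * phi (_ *: _)).
by rewrite mulrC.
Qed.

Lemma dilate1 phi : dilate 1 phi = phi.
Proof.
by apply/funext => x; rewrite /dilate invr1 scale1r expr1n invr1 mul1r.
Qed.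

Lemma dilateK r phi : r != 0 -> dilate r^-1 (dilate r phi) = phi.
Proof. by move=> r0; rewrite dilateM mulVf// dilate1. Qed.

Lemma supp_dilate_sub r phi x : r != 0 -> supp (dilate r phi) x ->
  supp phi (r^-1 *: x).
Proof.
move=> r0 sx B Bx.
have [y [/= phiy By]] := sx _ (@scaler_continuous _ _ r^-1 x _ Bx).
exists (r^-1 *: y); split => //=.
by move: phiy; rewrite /dilate mulf_eq0 negb_or => /andP[].
Qed.

Lemma supp_dilate r phi : r != 0 ->
  supp (dilate r phi) = [set r *: x | x in supp phi].
Proof.
move=> r0; apply/seteqP; split => [x sx|_ [x sx <-]].
  exists (r^-1 *: x); first exact: supp_dilate_sub.
  by rewrite scalerA mulfV// scale1r.
rewrite -[r in r *: x]invrK; apply: supp_dilate_sub; rewrite ?invr_eq0//.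
by rewrite dilateK.
Qed.

Lemma foldr_partial_dilate r phi (t : seq 'I_n) :
  r != 0 -> smooth_on setT phi ->
  foldr (@partial R n) (dilate r phi) t =
  fun x => r ^- n * r^-1 ^+ size t * foldr (@partial R n) phi t (r^-1 *: x).
Proof.
move=> r0 sphi; elim: t => [|i t IH].
  by apply/funext => x; rewrite expr0 mulr1.
rewrite [LHS]/= IH; apply/funext => x; rewrite /partial /=.
have [_ /(_ i) dphi] := sphi t (r^-1 *: x) I.
have ri0 : r^-1 != 0 by rewrite invr_eq0.
have D := is_derive_scale_comp R n (r ^- n * r^-1 ^+ size t) r^-1 _ x _ ri0
  dphi.
by rewrite derive_val exprSr mulrA.
Qed.

Lemma smooth_dilate r phi : r != 0 -> smooth_on setT phi ->
  smooth_on setT (dilate r phi).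
Proof.
move=> r0 sphi t x _; rewrite foldr_partial_dilate//.
have [cphi dphi] := sphi t (r^-1 *: x) I.
split=> [|i].
  have cs : {for x, continuous (foldr (@partial R n) phi t \o *:%R r^-1)}.
    by apply: continuous_comp; [exact: scaler_continuous|exact: cphi].
  exact: (cvgM (cvg_cst _) cs).
have ri0 : r^-1 != 0 by rewrite invr_eq0.
exact: (@ex_derive _ _ _ _ _ _ _
  (is_derive_scale_comp R n _ r^-1 _ x _ ri0 (dphi i))).
Qed.

Lemma test_function_dilate r phi : r != 0 -> test_function phi ->
  test_function (dilate r phi).
Proof.
move=> r0 [sphi cphi]; split; first exact: smooth_dilate.
have cr : {within supp phi, continuous (fun x : V => r *: x)}.
  by apply: continuous_subspaceT => x; exact: scaler_continuous.
by rewrite supp_dilate//; exact: (continuous_compact cr cphi).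
Qed.

Lemma integraln_monomial_dilate r phi (alpha : 'I_n -> nat) : 0 < r ->
  integraln (fun x => (\prod_i x 0 i ^+ alpha i) * dilate r phi x) =
  r ^+ (\sum_i alpha i) *
    integraln (fun x => (\prod_i x 0 i ^+ alpha i) * phi x).
Proof.
move=> r0; have rn0 : r != 0 by rewrite gt_eqF.
have rN0 : r ^+ n != 0 by rewrite expf_neq0.
set f := fun x => _ * phi x.
have -> : (fun x : V => (\prod_i x 0 i ^+ alpha i) * dilate r phi x) =
    (fun x => r ^+ (\sum_i alpha i) * r ^- n * f (r^-1 *: x)).
  apply/funext => x; rewrite /f /dilate.
  have -> : \prod_i x 0 i ^+ alpha i =
     r ^+ (\sum_i alpha i) * \prod_i (r^-1 *: x) 0 i ^+ alpha i.
    rewrite expr_sum -big_split /=; apply: eq_bigr => i _.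
    by rewrite mxE -exprMn mulVKf.
  exact: mulrACA.
rewrite integraln_scale_comp ?invr_gt0 ?mulr_gt0 ?exprn_gt0//; last first.
  by rewrite invr_gt0 exprn_gt0.
by rewrite exprVn invrK mulfVK.
Qed.

Lemma A0_dilate r phi : 0 < r -> A0 phi -> A0 (dilate r phi).
Proof.
move=> r0 [tphi iphi]; split.
  by apply: test_function_dilate => //; rewrite gt_eqF.
rewrite /dilate integraln_scale_comp ?invr_gt0 ?exprn_gt0//.
by rewrite iphi mulr1 exprVn invrK mulVf// expf_neq0// gt_eqF.
Qed.

Lemma Aq_dilate q r phi : 0 < r -> Aq q phi -> Aq q (dilate r phi).
Proof.
move=> r0 [A0phi mphi]; split; first exact: A0_dilate.
by move=> alpha /mphi mphi0; rewrite integraln_monomial_dilate// mphi0 mulr0.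
Qed.

Lemma Aq_mono q q' phi : (q <= q')%N -> Aq q' phi -> Aq q phi.
Proof.
move=> qq' [A0phi mphi]; split => // alpha /andP[a1 aq].
by apply: mphi; rewrite a1 (leq_trans aq).
Qed.

End dilate.

(** * Diameters of supports *)

Lemma sup_scale (R : realType) (r : R) (E : set R) : 0 < r -> has_sup E ->
  sup [set r * x | x in E] = r * sup E.
Proof.
move=> r0 [[x0 Ex0] [M EM]].
have ubE : has_ubound E by exists M.
have ubrE : has_ubound [set r * x | x in E].
  by exists (r * M) => _ [x Ex <-]; rewrite ler_pM2l//; exact: EM.
apply/eqP; rewrite eq_le; apply/andP; split.
  apply: ge_sup; first by exists (r * x0), x0.
  by move=> _ [x Ex <-]; rewrite ler_pM2l//; exact: ub_le_sup.
rewrite -ler_pdivlMl//; apply: ge_sup; first by exists x0.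
move=> x Ex; rewrite ler_pdivlMl//; apply: ub_le_sup => //.
by exists x.
Qed.

Section diameter.
Context (R : realType) (n : nat).
Local Notation V := 'rV[R]_n.
Implicit Types (phi : V -> R) (r : R) (x y : V).

Lemma eucl_dist_scale r x y : 0 <= r ->
  eucl_dist (r *: x) (r *: y) = r * eucl_dist x y.
Proof.
move=> r0; rewrite /eucl_dist.
have -> : \sum_i ((r *: x) 0 i - (r *: y) 0 i) ^+ 2 =
    r ^+ 2 * \sum_i (x 0 i - y 0 i) ^+ 2.
  by rewrite mulr_sumr; apply: eq_bigr => i _; rewrite !mxE -mulrBr exprMn.
by rewrite sqrtrM ?sqr_ge0// sqrtr_sqr ger0_norm.
Qed.

Lemma eucl_dist_bounded (K : set V) : compact K ->
  has_ubound [set eucl_dist x y | x in K & y in K].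
Proof.
move=> /compact_bounded /ex_strict_bound_gt0[M _ KM].
have cM x i : K x -> `|x 0 i| <= M.
  move=> Kx; apply: le_trans (ltW (KM x Kx)).
  rewrite /Num.norm /= mx_normrE.
  exact: (le_bigmax _ (fun ij => `|x ij.1 ij.2|) (0, i)).
exists (Num.sqrt (\sum_(i < n) (M + M) ^+ 2)) => _ [x Kx [y Ky <-]].
rewrite /eucl_dist; apply: ler_wsqrtr; apply: ler_sum => i _.
rewrite -real_normK ?num_real//; apply: lerXn2r; rewrite ?nnegrE//.
  by rewrite addr_ge0// (le_trans _ (cM x i Kx)).
by rewrite (le_trans (ler_normB _ _))// lerD// cM.
Qed.

Lemma A0_neq0 phi : A0 phi -> exists x, phi x != 0.
Proof.
move=> [_ iphi]; apply: contrapT => /forallNP phi0.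
have {}phi0 x : phi x = 0 by apply/eqP/negbNE/negP/phi0.
move: iphi; rewrite /integraln /Rintegral.
under eq_integral do rewrite phi0.
by rewrite integral0 /= => /eqP; rewrite eq_sym oner_eq0.
Qed.

Lemma has_sup_supp phi : A0 phi ->
  has_sup [set eucl_dist x y | x in supp phi & y in supp phi].
Proof.
move=> Aphi; split; last by apply: eucl_dist_bounded; case: Aphi => -[].
have [x px] := A0_neq0 phi Aphi.
have sx : supp phi x by exact: subset_closure.
by exists (eucl_dist x x), x => //; exists x.
Qed.

Lemma sdiam_dilate r phi : 0 < r -> A0 phi ->
  sdiam (dilate r phi) = r * sdiam phi.
Proof.
move=> r0 Aphi; rewrite /sdiam /diam -sup_scale//; last exact: has_sup_supp.
rewrite supp_dilate ?gt_eqF//; congr sup; apply/seteqP; split.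
  move=> _ [_ [x sx <-] [_ [y sy <-] <-]].
  exists (eucl_dist x y); first by exists x => //; exists y.
  by rewrite eucl_dist_scale// ltW.
move=> _ [_ [x sx [y sy <-]] <-].
exists (r *: x); first by exists x.
exists (r *: y); first by exists y.
by rewrite eucl_dist_scale// ltW.
Qed.

Lemma sdiam_gt0 phi : (1 <= n)%N -> A0 phi -> 0 < sdiam phi.
Proof.
move=> n1 Aphi; have [x px] := A0_neq0 phi Aphi.
pose i := Ordinal n1; pose e : V := delta_mx 0 i.
have cphi : {for x, continuous phi}.
  by case: Aphi => -[sphi _] _; have [] := sphi [::] x I.
(* By continuity [phi] is still nonzero at some point of the line through [x]
   in the first coordinate direction other than [x]. *)
have [t [t0 pt]] : exists t : R, t != 0 /\ phi (t *: e + x) != 0.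
  have ce : {for 0, continuous (fun t : R => t *: e + x)}.
    by apply: cvgD; [exact: scalel_continuous|exact: cvg_cst].
  have cpe : {for 0, continuous (phi \o (fun t : R => t *: e + x))}.
    by apply: continuous_comp => //; rewrite scale0r add0r.
  have U : nbhs ((phi \o (fun t : R => t *: e + x)) 0) [set y | y != 0].
    apply: open_nbhs_nbhs; split; first exact: open_neq.
    by rewrite /= scale0r add0r.
  have N : \forall t \near (0 : R)^', phi (t *: e + x) != 0.
    by apply: cvg_within; exact: (cpe _ U).
  have N0 : \forall t \near (0 : R)^', t != 0 by exact: nbhs_dnbhs_neq.
  by have [t [? ?]] := filter_ex (filterI N0 N); exists t.
have sx : supp phi x by exact: subset_closure.
have sy : supp phi (t *: e + x) by exact: subset_closure.
have [_ ub] := has_sup_supp phi Aphi.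
apply: lt_le_trans (ub_le_sup ub _); last first.
  by exists (t *: e + x) => //; exists x.
rewrite /eucl_dist sqrtr_gt0 (bigD1 i)//= ltr_pwDl//.
  by rewrite !mxE !eqxx mulr1 addrK exprn_even_gt0.
by apply: sumr_ge0 => j _; exact: sqr_ge0.
Qed.

End diameter.

(** * The two asymptotic scales *)

Section asymptotics.
Context (R : realType) (n : nat) (n_ge1 : (1 <= n)%N).
Local Notation net_index := ('rV[R]_n -> R).

(** Asymptotics along the index set, measured by the diameter of the support,
agree with asymptotics in the dilation parameter, the gauge being any
multiplicative function that does not vanish on the positive reals. *)
Lemma bigO_e_sdiam (x : net_index -> R) (g : R -> R) :
  (forall s t, g (s * t) = g s * g t) -> (forall s, 0 < s -> g s != 0) ->
  bigO_e x (fun e => g (sdiam e)) <->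
  exists q, forall phi, Aq q phi ->
    (fun r => x (dilate r phi)) =O_ (0^'+) g.
Proof.
move=> gM g0; split.
  move=> [_ [[q _ <-] bO]]; exists q => phi Aphi; have Aphi0 := Aphi.1.
  have [H [H0 [eps0 [[[_ [r0 [/andP[r00 _] eps0E]]] _] xH]]]] := bO _ Aphi.
  apply/eqO_exP; exists (H * `|g (sdiam phi)|).
    by rewrite mulr_gt0// normr_gt0 g0// sdiam_gt0.
  near=> r.
  have rgt0 : 0 < r by near: r; exact: nbhs_right_gt.
  have rr0 : r <= r0 by near: r; exact: nbhs_right_le.
  have -> : H * `|g (sdiam phi)| * `|g r| = H * `|g (sdiam (dilate r phi))|.
    by rewrite sdiam_dilate// gM normrM -mulrA [`|g r| * _]mulrC.
  apply: xH; split; last exact: Aq_dilate.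
  split; first exact: A0_dilate.
  (* Below [eps0 = dilate r0 phi] lie all the [dilate r phi] with [r <= r0]. *)
  exists (r / r0); split; first by rewrite divr_gt0//= ler_pdivrMr ?mul1r.
  by rewrite eps0E dilateM divfK ?gt_eqF.
move=> [q xO]; exists (Aq q); split; first by exists q.
move=> phi Aphi; have Aphi0 := Aphi.1.
have d0 := sdiam_gt0 R n phi n_ge1 Aphi0.
have /eqO_exP[C C0 xC] := xO _ Aphi.
have [e /= e0 eC] := xC.
exists (C / `|g (sdiam phi)|); split; first by rewrite divr_gt0// normr_gt0 g0.
(* The estimate is valid for parameters below [e], and [index_le] needs a
   parameter of at most 1. *)
pose r0 := Num.min (e / 2) 1.
have r00 : 0 < r0 by rewrite lt_min divr_gt0//=.
have r0e : r0 < e by rewrite gt_min ltr_pdivrMr// ltr_pMr// ltr1n.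
exists (dilate r0 phi); split.
  split; last exact: Aq_dilate.
  split; first exact: A0_dilate.
  by exists r0; rewrite r00 ge_min lexx orbT.
move=> _ [[_ [s [/andP[s0 s1] ->]]] _].
rewrite dilateM sdiam_dilate ?mulr_gt0// [in leRHS]gM normrM.
have sr0 : 0 < s * r0 by rewrite mulr_gt0.
rewrite mulrCA mulfVK ?normr_eq0 ?g0// [leRHS]mulrC.
apply: eC => //; rewrite /ball_ /= sub0r normrN gtr0_norm//.
by rewrite (le_lt_trans _ r0e)// ger_pMl.
Unshelve. all: by end_near. Qed.

End asymptotics.

Theorem theorem25 (R : realType) (n : nat) (n_ge1 : (1 <= n)%N)
    (Omega : set 'rV[R]_n) (Omega_open : open Omega)
    (u : ('rV[R]_n -> R) -> 'rV[R]_n -> R) (u_Pe : Pe Omega u) :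
  (EMe Omega (vee u) <->
     forall K, compact_in K Omega -> forall alpha : 'I_n -> nat,
       exists N : nat,
         bigO_e (fun eps => sup_partial Omega K alpha eps (u eps))
                (fun eps => sdiam eps ^- N))
  /\
  (Ne Omega (vee u) <->
     forall K, compact_in K Omega -> forall (alpha : 'I_n -> nat) (m : nat),
       bigO_e (fun eps => sup_partial Omega K alpha eps (u eps))
              (fun eps => sdiam eps ^+ m)).
Proof.
have negM (N : nat) (s t : R) : (s * t) ^- N = s ^- N * t ^- N.
  by rewrite exprMn invfM.
have neg0 (N : nat) (s : R) : 0 < s -> s ^- N != 0.
  by move=> s0; rewrite invr_eq0 expf_neq0// gt_eqF.
have posM (m : nat) (s t : R) : (s * t) ^+ m = s ^+ m * t ^+ m.
  exact: exprMn.
have pos0 (m : nat) (s : R) : 0 < s -> s ^+ m != 0.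
  by move=> s0; rewrite expf_neq0// gt_eqF.
have bigO_neg N x :=
  bigO_e_sdiam R n n_ge1 x (fun s => s ^- N) (negM N) (neg0 N).
have bigO_pos m x :=
  bigO_e_sdiam R n n_ge1 x (fun s => s ^+ m) (posM m) (pos0 m).
split; split.
- move=> [_ H] K KO alpha; have [N HN] := H K KO alpha.
  by exists N; apply/bigO_neg; exists N.
- move=> H; split=> // K KO alpha.
  have [N /bigO_neg[q Hq]] := H K KO alpha.
  (* [q] ensures that the estimate holds, [N] that its order is large enough. *)
  exists (maxn N q) => phi Aphi.
  have /eqO_exP[C C0 xC] := Hq phi (Aq_mono _ _ _ _ _ (leq_maxr N q) Aphi).
  apply/eqO_exP; exists C => //; near=> r.
  have r0 : 0 < r by near: r; exact: nbhs_right_gt.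
  have r1 : r <= 1 by near: r; exact: nbhs_right_le.
  have : `|sup_partial Omega K alpha (dilate r phi) (u (dilate r phi))| <=
      C * `|r ^- N| by near: r.
  have rN_ge0 k : 0 <= r ^- k by rewrite invr_ge0 exprn_ge0// ltW.
  move=> /le_trans; apply; rewrite ler_pM2l// !ger0_norm//.
  rewrite lef_pV2 ?posrE ?exprn_gt0//.
  by apply: ler_wiXn2l; rewrite ?leq_maxl// ltW.
- move=> [_ H] K KO alpha m; have [q Hq] := H K KO alpha m.
  by apply/bigO_pos; exists q.
- move=> H; split=> // K KO alpha m.
  by have /bigO_pos[q Hq] := H K KO alpha m; exists q.
Unshelve. all: by end_near. Qed.
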